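(* Let $\pi = \{I_1,\ldots,I_m\}$ be a partition of $\{1,\ldots,N\}$, where $N \ge 1$. For all $A \in \overline{\mathcal{S}_\pi}$ and $B \in \mathbb{C}^{m\times m}$, \[ \sigma(A)\setminus\{0\} = \sigma(\Theta^\downarrow_\pi(A))\setminus\{0\} \qquad\text{and}\qquad \sigma(B)\setminus\{0\} = \sigma(\Theta^\uparrow_\pi(B))\setminus\{0\}. \] In particular, $\Theta^\downarrow_\pi : \overline{\mathcal{S}_\pi}\to\mathbb{C}^{m\times m}$ and $\Theta^\uparrow_\pi : \mathbb{C}^{m\times m}\to\overline{\mathcal{S}_\pi}$ preserve the spectral radius. Furthermore, applying $\Theta^\uparrow_\pi$ to $B$ adds a zero eigenvalue of geometric multiplicity $N-m$ to $\sigma(B)$ (that is, $\dim\ker\Theta^\uparrow_\pi(B) = \dim\ker B + N - m$), whereas applying $\Theta^\downarrow_\pi$ to $A$ reduces the geometric multiplicity of the zero eigenvalue of $A$ by $N-m$ (that is, $\dim\ker\Theta^\downarrow_\pi(A) = \dim\ker A - (N-m)$).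
   Context: $\overline{\mathcal{S}_\pi}$ is the closure of the set $\mathcal{S}_\pi$ of matrices $A\in\mathbb{C}^{N\times N}$ for which $\pi$ is the coarsest partition such that $A$ is constant on each block $I_i\times I_j$; equivalently, $\overline{\mathcal{S}_\pi}$ is the set of all $A\in\mathbb{C}^{N\times N}$ constant on each block $I_i\times I_j$. $\sigma(\cdot)$ denotes the usual spectrum (set of eigenvalues) of a square matrix. The matrix $\mathcal{W}_\pi \in \mathbb{C}^{N\times m}$ has $(i,j)$ entry $1$ if $i\in I_j$ and $0$ otherwise, and $D_\pi := \operatorname{diag}(|I_1|,\ldots,|I_m|)$. Define $\Theta^\downarrow_\pi(A) := D_\pi^{-1/2}\mathcal{W}_\pi^*A\mathcal{W}_\pi D_\pi^{-1/2}$ for $A \in \mathbb{C}^{N\times N}$ and $\Theta^\uparrow_\pi(B) := \mathcal{W}_\pi D_\pi^{-1/2}BD_\pi^{-1/2}\mathcal{W}_\pi^*$ for $B\in\mathbb{C}^{m\times m}$. *)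

(* Defs.v *)
From mathcomp Require Import all_boot all_order all_algebra spectral sesquilinear.
From mathcomp Require Import all_classical all_reals topology normedtype.
From mathcomp Require Import complex.

Set Implicit Arguments.
Unset Strict Implicit.
Unset Printing Implicit Defensive.

Import Order.TTheory GRing.Theory Num.Theory.
Import numFieldNormedType.Exports.

Local Open Scope classical_set_scope.
Local Open Scope ring_scope.
Local Open Scope sesquilinear_scope.

(* The partition is given with its labelling I_1, ..., I_m; [partition]
   requires nonempty, pairwise disjoint blocks, and injectivity makes m the
   number of blocks. *)
Definition labelled_partition (N m : nat) (I : 'I_m -> {set 'I_N}) : Prop :=
  injective I /\ finset.partition (I @: [set: 'I_m])%SET [set: 'I_N]%SET.

Definition block_constant (K : Type) (N : nat) (P : {set {set 'I_N}})
    (A : 'M[K]_N) : Prop :=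
  forall X Y : {set 'I_N}, X \in P -> Y \in P ->
  forall i i' j j' : 'I_N, i \in X -> i' \in X -> j \in Y -> j' \in Y ->
  A i j = A i' j'.

Definition refines (N : nat) (Q P : {set {set 'I_N}}) : Prop :=
  forall X, X \in Q -> exists2 Y, Y \in P & X \subset Y.

(* S_pi: pi makes A block-constant, and every other partition doing so
   refines pi. *)
Definition stratum (C : numClosedFieldType) (N m : nat) (I : 'I_m -> {set 'I_N}) :
    set 'M[C]_N :=
  [set A | block_constant (I @: [set: 'I_m])%SET A /\
           forall Q : {set {set 'I_N}}, finset.partition Q [set: 'I_N]%SET ->
             block_constant Q A -> refines Q (I @: [set: 'I_m])%SET].

Definition closed_stratum (C : numClosedFieldType) (N m : nat)
    (I : 'I_m -> {set 'I_N}) : set 'M[C]_N :=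
  closure (stratum (C := C) I).

Definition Wmx (C : numClosedFieldType) (N m : nat) (I : 'I_m -> {set 'I_N}) :
    'M[C]_(N, m) :=
  \matrix_(i, j) (i \in I j)%:R.

Definition block_sizes (C : numClosedFieldType) (N m : nat)
    (I : 'I_m -> {set 'I_N}) : 'rV[C]_m :=
  \row_j #|I j|%:R.

(* D^(-1/2), for D = diag_mx (block_sizes I). *)
Definition Dinvsqrt (C : numClosedFieldType) (N m : nat)
    (I : 'I_m -> {set 'I_N}) : 'M[C]_m :=
  diag_mx (map_mx (fun x => (sqrtC x)^-1) (block_sizes C I)).

Definition Theta_down (C : numClosedFieldType) (N m : nat)
    (I : 'I_m -> {set 'I_N}) (A : 'M[C]_N) : 'M[C]_m :=
  Dinvsqrt C I *m (Wmx C I)^t* *m A *m Wmx C I *m Dinvsqrt C I.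

Definition Theta_up (C : numClosedFieldType) (N m : nat)
    (I : 'I_m -> {set 'I_N}) (B : 'M[C]_m) : 'M[C]_N :=
  Wmx C I *m Dinvsqrt C I *m B *m Dinvsqrt C I *m (Wmx C I)^t*.

Definition spectrum (C : numClosedFieldType) (n : nat) (A : 'M[C]_n) : set C :=
  [set a | eigenvalue A a].

(* [normc] is the R-valued modulus on R[i]. The supremum is a maximum when
   n > 0, the spectrum being then finite and nonempty. *)
Definition spectral_radius (R : realType) (n : nat) (A : 'M[R[i]]_n) : R :=
  sup [set ComplexField.Normc.normc a | a in spectrum A].

(* The columns of [cokermx A] span the column vectors v with A *m v = 0. *)
Definition dim_ker (C : numClosedFieldType) (n : nat) (A : 'M[C]_n) : nat :=
  \rank (cokermx A).

(* Main.v *)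
Require Import Defs.
From mathcomp Require Import all_boot all_order all_algebra spectral sesquilinear.
From mathcomp Require Import all_classical all_reals topology normedtype.
From mathcomp Require Import complex.

Set Implicit Arguments.
Unset Strict Implicit.
Unset Printing Implicit Defensive.

Import Order.TTheory GRing.Theory Num.Theory.
Import numFieldNormedType.Exports.

Local Open Scope classical_set_scope.
Local Open Scope ring_scope.

(** Write V = W D^(-1/2) and U = D^(-1/2) W^*. The columns of W are the indicator
vectors of the blocks, so W^* W = D and hence U V = 1 ([coisometry]), while
Theta_down A = U A V and Theta_up B = V B U. Thus Theta_up B is B acting on an
m-dimensional space of vectors, extended by zero on a complement. This alone
gives the claims on Theta_up: a left eigenvector v of B becomes v U, a left
eigenvector w of V B U becomes w V, and neither vanishes when the eigenvalue is
nonzero ([spectrum_dilation]); B and V B U have the same rank, so their kernels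
differ in dimension by N - m ([dim_ker_dilation]). As N and m are positive both
spectra are nonempty, so the spectral radius depends only on the nonzero
eigenvalues ([eq_spectral_radius]).

The claims on Theta_down follow from those on Theta_up applied to
B = Theta_down A, once Theta_up (Theta_down A) = A is known on the closed
stratum ([Theta_downK]). This holds because the closed stratum is the set of
block-constant matrices, which are the matrices W B W^*
([block_constant_factor]). One inclusion is closedness of equations between
entries. For the other, a block-constant matrix is perturbed by a small multiple
of the label of the row, with the multiple chosen so that the diagonal
entries separate the blocks ([block_constant_closed_stratum]). *)

(** * Dilations V B U with U V = 1 *)

Lemma compression_dilation (F : fieldType) (n m : nat)
    (V : 'M[F]_(n, m)) (U : 'M[F]_(m, n)) (B : 'M[F]_m) :
  U *m V = 1%:M -> U *m (V *m B *m U) *m V = B.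
Proof. by move=> UV; rewrite -!mulmxA UV mulmx1 mulmxA UV mul1mx. Qed.

(** Multiplication by U and by V carries left eigenvectors back and forth; the
image of a nonzero one is nonzero for B because U V = 1, and for V B U because
w V = 0 would force a w = 0. *)
Lemma spectrum_dilation (C : numClosedFieldType) (n m : nat)
    (V : 'M[C]_(n, m)) (U : 'M[C]_(m, n)) (B : 'M[C]_m) :
  U *m V = 1%:M -> spectrum B `\ 0 = spectrum (V *m B *m U) `\ 0.
Proof.
move=> UV; apply/seteqP; split=> a [/= /eigenvalueP[v vE v0] /eqP a0].
  split; last exact/eqP; apply/eigenvalueP; exists (v *m U).
    by rewrite !mulmxA -(mulmxA v) UV mulmx1 vE scalemxAl.
  by apply: contraNneq v0 => vU; rewrite -[v]mulmx1 -UV mulmxA vU mul0mx.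
split; last exact/eqP; apply/eigenvalueP; exists (v *m V).
  by rewrite scalemxAl -vE !mulmxA -(mulmxA _ U) UV mulmx1.
apply: contraNneq v0 => vV.
by move: vE; rewrite !mulmxA vV !mul0mx => /esym/eqP; rewrite scalemx_eq0 (negPf a0).
Qed.

(** Each of B and V B U is obtained from the other by multiplications. *)
Lemma mxrank_dilation (F : fieldType) (n m : nat)
    (V : 'M[F]_(n, m)) (U : 'M[F]_(m, n)) (B : 'M[F]_m) :
  U *m V = 1%:M -> \rank (V *m B *m U) = \rank B.
Proof.
move=> UV; apply/eqP; rewrite eqn_leq; apply/andP; split.
  exact: leq_trans (mxrankM_maxl _ _) (mxrankM_maxr _ _).
rewrite -{1}(compression_dilation B UV).
exact: leq_trans (mxrankM_maxl _ _) (mxrankM_maxr _ _).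
Qed.

(** By rank-nullity, as the ranks agree. *)
Lemma dim_ker_dilation (C : numClosedFieldType) (n m : nat)
    (V : 'M[C]_(n, m)) (U : 'M[C]_(m, n)) (B : 'M[C]_m) : U *m V = 1%:M ->
  (dim_ker (V *m B *m U))%:Z = (dim_ker B)%:Z + n%:Z - m%:Z.
Proof.
move=> UV; have rkE := mxrank_dilation B UV.
have rkn : (\rank B <= n)%N by rewrite -rkE rank_leq_row.
rewrite /dim_ker !mxrank_coker rkE -!subzn ?rank_leq_row//.
by rewrite [RHS]addrAC [_ - m%:Z]addrAC subrr add0r addrC.
Qed.

(** * Spectral radius *)

Lemma spectrum_neq0 (C : numClosedFieldType) (n : nat) (A : 'M[C]_n) :
  (0 < n)%N -> spectrum A !=set0.
Proof.
move=> n0; have /closed_rootP[a ra] : size (char_poly A) != 1%N.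
  by rewrite size_char_poly eqSS -lt0n.
by exists a; rewrite /spectrum /= eigenvalue_root_char.
Qed.

(** The eigenvalues are the roots of the characteristic polynomial, which is split
over R[i]; the sum of the moduli of the roots is a crude bound. *)
Lemma has_ubound_normc_spectrum (R : realType) (n : nat) (A : 'M[R[i]]_n) :
  has_ubound [set ComplexField.Normc.normc a | a in spectrum A].
Proof.
have [r rE] := closed_field_poly_normal (char_poly A).
exists (\sum_(z <- r) ComplexField.Normc.normc z) => _ /= [a /= + <-].
rewrite /spectrum /= eigenvalue_root_char rE.
have := monic_neq0 (char_poly_monic A); rewrite -lead_coef_eq0 => l0.
rewrite rootZ// root_prod_XsubC => ar.
rewrite (big_rem a)//= lerDl; apply: sumr_ge0 => -[x y] _; exact: sqrtr_ge0.
Qed.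

(** A zero eigenvalue of A is harmless: the spectrum of B is nonempty and moduli are
nonnegative, so the spectral radius of B is at least 0. *)
Lemma le_spectral_radius (R : realType) (n p : nat) (A : 'M[R[i]]_n)
    (B : 'M[R[i]]_p) : (0 < n)%N -> (0 < p)%N ->
  spectrum A `\ 0 `<=` spectrum B -> spectral_radius A <= spectral_radius B.
Proof.
move=> n0 p0 AB; apply: ge_sup.
  by have [a aA] := spectrum_neq0 A n0; exists (ComplexField.Normc.normc a), a.
have leB b : spectrum B b -> ComplexField.Normc.normc b <= spectral_radius B.
  move=> bB; apply: ub_le_sup; first exact: has_ubound_normc_spectrum.
  by exists b.
move=> _ [a aA <-]; have [->|/eqP a0] := eqVneq a 0; last exact/leB/AB.
rewrite ComplexField.Normc.normc0; have [b /leB] := spectrum_neq0 B p0.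
by apply: le_trans; case: b => x y; exact: sqrtr_ge0.
Qed.

Lemma eq_spectral_radius (R : realType) (n p : nat) (A : 'M[R[i]]_n)
    (B : 'M[R[i]]_p) : (0 < n)%N -> (0 < p)%N ->
  spectrum A `\ 0 = spectrum B `\ 0 -> spectral_radius A = spectral_radius B.
Proof.
move=> n0 p0 AB; apply/eqP; rewrite eq_le; apply/andP; split.
  by apply: le_spectral_radius => //; rewrite AB; exact: subDsetl.
by apply: le_spectral_radius => //; rewrite -AB; exact: subDsetl.
Qed.

(** * Strata and their closures *)

(** A labelled partition is the family of fibres of a map lab, which makes
membership in a block an equation between labels. *)
Lemma labelled_partition_label (N m : nat) (I : 'I_m -> {set 'I_N}) :
  labelled_partition I ->
  exists lab : 'I_N -> 'I_m, forall i k, (i \in I k) = (lab i == k).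
Proof.
move=> [Iinj /and3P[/eqP covI /finset.trivIsetP trivI _]].
have labP i : exists k, i \in I k.
  have : i \in finset.cover (I @: [set: 'I_m])%SET by rewrite covI inE.
  by case/bigcupP => _ /imsetP[k _ ->] ik; exists k.
exists (fun i => xchoose (labP i)) => i k; apply/idP/eqP => [ik|<-]; last first.
  exact: (xchooseP (labP i)).
apply: contraTeq ik => kN; have := trivI _ _ (imset_f I _) (imset_f I _).
move=> /(_ (xchoose (labP i)) k (finset.in_setT _) (finset.in_setT _)).
rewrite (inj_eq Iinj) => /(_ kN) /pred0P/(_ i) /=.
by rewrite (xchooseP (labP i)) /= => ->.
Qed.

Lemma labelled_partition_block (N m : nat) (I : 'I_m -> {set 'I_N}) :
  labelled_partition I -> forall k, exists i, i \in I k.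
Proof.
move=> [_ /and3P[_ _ I0]] k; apply/finset.set0Pn; apply: contraNneq I0 => <-.
exact: imset_f.
Qed.

(** A finite set misses an interval ]0, d[. The order of C is partial, but an
element a that is not positive cannot be equal to a positive t, so only
positive reals need to be compared with d. *)
Lemma exists_small_notin (C : numClosedFieldType) (e : C) (s : seq C) :
  0 < e -> exists t, [/\ 0 < t, t < e & t \notin s].
Proof.
move=> e0; suff [d [d0 de ds]] : exists d,
    [/\ 0 < d, d <= e & forall t, 0 < t -> t < d -> t \notin s].
  have [h0 hd] : 0 < d / 2 /\ d / 2 < d.
    by rewrite divr_gt0// ltr_pdivrMr// ltr_pMr// ltr1n.
  by exists (d / 2); rewrite h0 (lt_le_trans hd de) ds.
elim: s => [|a s [d [d0 de ds]]]; first by exists e.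
have [a0|aN] := boolP (0 < a); last first.
  exists d; split=> // t t0 td; rewrite inE negb_or ds// andbT.
  by apply: contraNneq aN => <-.
have cmp := real_comparable (gtr0_real d0) (gtr0_real a0).
exists (Num.min d a); split=> [||t t0].
- by rewrite comparable_lt_min// d0.
- by rewrite comparable_ge_min// de.
rewrite comparable_lt_min// => /andP[td ta].
by rewrite inE negb_or ds// (lt_eqF ta).
Qed.

Section Strata.
Variables (C : numClosedFieldType) (N m : nat) (I : 'I_m -> {set 'I_N}).
Hypothesis hI : labelled_partition I.

(** If two entries that should agree differed, a block-constant matrix closer to A
than half of their distance would contradict the triangle inequality. *)
Lemma closed_stratum_block_constant (A : 'M[C]_N) :
  closed_stratum I A -> block_constant (I @: [set: 'I_m])%SET A.
Proof.
move=> clA X Y PX PY i i' j j' iX i'X jY j'Y.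
apply/eqP; apply: contraT; rewrite -subr_eq0 => neq.
have e0 : 0 < `|A i j - A i' j'| / 2 by rewrite divr_gt0// normr_gt0.
have /clA[B [[cstB _] [_ bB]]] : nbhs A (ball A (`|A i j - A i' j'| / 2)).
  exact: nbhsx_ballx.
have := bB i j; have := bB i' j'; rewrite -(cstB X Y PX PY i i' j j') //.
rewrite -ball_normE /= => b1 b2.
have := ltrD b2 b1; rewrite -splitr [X in _ + X]distrC => /(le_lt_trans (ler_normD _ _)).
by rewrite addrA subrK ltxx.
Qed.

(** For small t > 0 add t * lab i to every entry of row i. The result is still
block-constant, and any partition Q making it block-constant identifies its
diagonal entries within each block of Q. So Q refines the partition as soon as
diagonal entries with different labels differ, which fails for only finitely
many t. *)
Lemma block_constant_closed_stratum (A : 'M[C]_N) :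
  block_constant (I @: [set: 'I_m])%SET A -> closed_stratum I A.
Proof.
have [lab labE] := labelled_partition_label hI.
move=> cstA O /nbhs_ballP[e /= e0 AO].
have m1 : 0 < m.+1%:R :> C by rewrite ltr0n.
(* the values of t for which two diagonal entries of A' with distinct labels
   coincide *)
pose s := [seq (A ij.2 ij.2 - A ij.1 ij.1) / ((lab ij.1)%:R - (lab ij.2)%:R)
          | ij : 'I_N * 'I_N].
(* the perturbation has entries t * lab i < t * (m + 1) *)
have [t [t0 te ts]] := exists_small_notin s (divr_gt0 e0 m1).
pose A' : 'M[C]_N := \matrix_(i, j) (A i j + t * (lab i)%:R).
exists A'; split; last first.
  apply: AO; split=> // i j; rewrite -ball_normE /= mxE opprD addNKr normrN.
  rewrite ger0_norm ?mulr_ge0 ?ler0n ?ltW//.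
  apply: le_lt_trans (_ : t * m.+1%:R < e); last by rewrite -ltr_pdivlMr.
  by rewrite ler_pM2l// ler_nat ltnW// ltnW// ltnS.
split=> [X Y /[dup] PX /imsetP[k _ XE] PY i i' j j' iX i'X jY j'Y|].
  rewrite !mxE (cstA X Y PX PY i i' j j')//.
  by move: iX i'X; rewrite XE !labE => /eqP-> /eqP->.
move=> Q /and3P[_ _ Q0] cstQ X QX.
have /finset.set0Pn[x xX] : X != finset.set0 by apply: contraNneq Q0 => <-.
exists (I (lab x)); first exact: imset_f.
apply/fintype.subsetP => y yX; rewrite labE; apply: contraNT ts => neq.
have := cstQ X X QX QX x y x y xX yX xX yX; rewrite !mxE => xyE.
apply/fintype.imageP; exists (x, y) => //=.
have d0 : (lab x)%:R - (lab y)%:R != 0 :> C.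
  by rewrite subr_eq0 eqr_nat eq_sym.
apply: (canRL (mulfK d0)); rewrite mulrBr.
apply/eqP; rewrite subr_eq addrAC -xyE eq_sym; apply/eqP.
by rewrite addrAC subrr add0r.
Qed.

(** * The maps Theta as dilation and compression *)

Let V := Wmx C I *m Dinvsqrt C I.
Let U := Dinvsqrt C I *m ((Wmx C I)^t*)%sesqui.

Lemma Wmx_adj : ((Wmx C I)^t*)%sesqui = (Wmx C I)^T.
Proof. by apply/matrixP => i j; rewrite !mxE conjC_nat. Qed.

(** The blocks are pairwise disjoint, so their indicator vectors are orthogonal. *)
Lemma Wmx_gram : (Wmx C I)^T *m Wmx C I = diag_mx (block_sizes C I).
Proof.
have [lab labE] := labelled_partition_label hI.
apply/matrixP => k l; rewrite !mxE.
under eq_bigr do rewrite !mxE -natrM mulnb.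
case: eqVneq => [<-|kl].
  under eq_bigr do rewrite andbb.
  by rewrite -natr_sum -big_mkcond sum1_card.
apply: big1 => i _; rewrite !labE; case: eqP => // ->.
by rewrite (negPf kl).
Qed.

(** Blocks of a partition are nonempty; this makes D^(-1/2) a genuine inverse. *)
Lemma sqrt_block_size_neq0 k : sqrtC (block_sizes C I 0 k) != 0.
Proof.
rewrite sqrtC_eq0 mxE pnatr_eq0 -lt0n card_gt0; apply/finset.set0Pn.
exact: labelled_partition_block.
Qed.

Lemma coisometry : U *m V = 1%:M.
Proof.
rewrite /U /V Wmx_adj mulmxA -[_ *m _ *m Wmx _ _]mulmxA Wmx_gram.
rewrite !mulmx_diag -diag_const_mx; congr diag_mx; apply/rowP => k.
have := sqrt_block_size_neq0 k; rewrite !mxE => D0.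
by rewrite -[X in _ * X / _]sqrtCK expr2 mulrA mulVf// mul1r divff.
Qed.

Lemma Theta_downE A : Theta_down I A = U *m A *m V.
Proof. by rewrite /Theta_down !mulmxA. Qed.

Lemma Theta_upE B : Theta_up I B = V *m B *m U.
Proof. by rewrite /Theta_up !mulmxA. Qed.

(** The (i, j) entry of W B W^T is the entry of B at the labels of i and j; in the
converse direction B is read off at one representative of each block. *)
Lemma block_constant_factor (A : 'M[C]_N) :
  block_constant (I @: [set: 'I_m])%SET A <->
  exists B, A = Wmx C I *m B *m (Wmx C I)^T.
Proof.
have [lab labE] := labelled_partition_label hI.
have WE B i j : (Wmx C I *m B *m (Wmx C I)^T) i j = B (lab i) (lab j).
  rewrite mxE (bigD1 (lab j))//= big1 => [|k kN]; last first.
    by rewrite !mxE labE eq_sym (negPf kN) mulr0.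
  rewrite mxE (bigD1 (lab i))//= big1 => [|k kN]; last first.
    by rewrite !mxE labE eq_sym (negPf kN) mul0r.
  by rewrite !mxE !labE !eqxx !addr0 mul1r mulr1.
split=> [cstA|[B ->] X Y /imsetP[k _ ->] /imsetP[l _ ->] i i' j j'].
  have repP k := labelled_partition_block hI k.
  exists (\matrix_(k, l) A (xchoose (repP k)) (xchoose (repP l))).
  apply/matrixP => i j; rewrite WE mxE.
  apply: (cstA (I (lab i)) (I (lab j))); rewrite ?imset_f ?labE// -labE.
    exact: (xchooseP (repP _)).
  exact: (xchooseP (repP _)).
by rewrite !labE !WE => /eqP-> /eqP-> /eqP-> /eqP->.
Qed.

Lemma Theta_up_closed_stratum B : closed_stratum I (Theta_up (C := C) I B).
Proof.
apply/block_constant_closed_stratum/block_constant_factor.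
exists (Dinvsqrt C I *m B *m Dinvsqrt C I).
by rewrite /Theta_up Wmx_adj !mulmxA.
Qed.

(** On the closed stratum A = W B W^T = V (D^(1/2) B D^(1/2)) U, so compressing A
and dilating again gives A back. *)
Lemma Theta_downK A :
  closed_stratum I A -> Theta_up (C := C) I (Theta_down I A) = A.
Proof.
move=> /closed_stratum_block_constant/block_constant_factor[B AE].
pose S := diag_mx (map_mx sqrtC (block_sizes C I)).
have DS : Dinvsqrt C I *m S = 1%:M.
  rewrite mulmx_diag -diag_const_mx; congr diag_mx; apply/rowP => k.
  by have := sqrt_block_size_neq0 k; rewrite !mxE => D0; rewrite mulVf.
have SD : S *m Dinvsqrt C I = 1%:M by apply: mulmx1C.
have {}AE : A = V *m (S *m B *m S) *m U.
  rewrite AE /V /U Wmx_adj !mulmxA -[Wmx C I *m _ *m S]mulmxA DS mulmx1.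
  by rewrite -[_ *m S *m _]mulmxA SD mulmx1.
rewrite Theta_upE Theta_downE [RHS]AE; congr (_ *m _ *m _); rewrite AE.
exact/compression_dilation/coisometry.
Qed.

End Strata.

Theorem proposition5p7 (R : realType) (N m : nat) (I : 'I_m -> {set 'I_N})
    (hN : (0 < N)%N) (hI : labelled_partition I) :
  (forall A : 'M[R[i]]_N, closed_stratum I A ->
     [/\ spectrum A `\ 0 = spectrum (Theta_down I A) `\ 0,
         spectral_radius (Theta_down I A) = spectral_radius A
       & (dim_ker (Theta_down I A))%:Z = (dim_ker A)%:Z - (N%:Z - m%:Z)]) /\
  (forall B : 'M[R[i]]_m,
     [/\ closed_stratum I (Theta_up I B),
         spectrum B `\ 0 = spectrum (Theta_up I B) `\ 0,
         spectral_radius (Theta_up I B) = spectral_radius B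
       & (dim_ker (Theta_up I B))%:Z = (dim_ker B)%:Z + N%:Z - m%:Z]).
Proof.
(* N > 0 forces the existence of a block *)
have m0 : (0 < m)%N.
  have [lab _] := labelled_partition_label hI.
  exact: leq_ltn_trans (ltn_ord (lab (Ordinal hN))).
have UV := coisometry R[i] hI.
have upP (B : 'M[R[i]]_m) :
    [/\ closed_stratum I (Theta_up I B),
        spectrum B `\ 0 = spectrum (Theta_up I B) `\ 0,
        spectral_radius (Theta_up I B) = spectral_radius B
      & (dim_ker (Theta_up I B))%:Z = (dim_ker B)%:Z + N%:Z - m%:Z].
  have spE : spectrum B `\ 0 = spectrum (Theta_up I B) `\ 0.
    by rewrite Theta_upE; exact: spectrum_dilation.
  split=> //; first exact: Theta_up_closed_stratum.
    exact: eq_spectral_radius.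
  by rewrite Theta_upE; exact: dim_ker_dilation.
(* the claims for A are those for B := Theta_down A, as A = Theta_up B *)
split=> // A clA; have [_] := upP (Theta_down I A).
rewrite Theta_downK// => -> -> ->; split=> //.
by rewrite opprB addrA subrK addrK.
Qed.
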